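(* Let $(X,d)$ be a compact metric space and let $(X,\mathbb{F})$ be an equicontinuous non-autonomous dynamical system generated by a commutative family $\mathbb{F}=\{f_n:n\in\mathbb{N}\}$ of homeomorphisms of $X$. Then $(X,\mathbb{F})$ is topologically transitive if and only if $\mathcal{O}(x)$ is dense in $X$ for all $x\in X$ (and hence, in this case, $(X,\mathbb{F})$ is minimal).
   Context: $X$ is non-empty and $\mathbb{N}=\{1,2,3,\dots\}$. The family $\mathbb{F}$ is commutative if $f_n\circ f_m=f_m\circ f_n$ for all $n,m$. The non-autonomous system $(X,\mathbb{F})$ has time-$n$ states $\omega_n(x)$, $n\in\mathbb{Z}$, defined by $\omega_0(x)=x$, $\omega_n(x)=f_n(\omega_{n-1}(x))$ for $n\ge 1$, and $\omega_n(x)=f_{-n}^{-1}(\omega_{n+1}(x))$ for $n<0$; thus $\omega_n=f_n\circ\cdots\circ f_1$ and $\omega_{-n}=f_n^{-1}\circ\cdots\circ f_1^{-1}$ for $n\geq 1$. The orbit of $x$ is $\mathcal{O}(x)=\{\omega_n(x):n\in\mathbb{Z}\}$. $(X,\mathbb{F})$ is equicontinuous if for each $\epsilon>0$ there exists $\delta>0$ such that for all $x,y\in X$, $d(x,y)<\delta$ implies $d(\omega_n(x),\omega_n(y))<\epsilon$ for all $n\in\mathbb{Z}$. It is topologically transitive if for every pair of non-empty open sets $U,V$ in $X$ there exists $k\in\mathbb{Z}$ such that $\omega_k(U)\cap V\neq\emptyset$. A set $Y\subseteq X$ is invariant if $\omega_k(Y)\subseteq Y$ for all $k\in\mathbb{Z}$.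 $(X,\mathbb{F})$ is minimal if $X$ is non-empty and no proper non-empty subset of $X$ is closed and invariant. *)

(* Defs.v *)
From HB Require Import structures.
From mathcomp Require Import all_boot all_order all_algebra.
From mathcomp Require Import all_classical all_reals all_analysis.

Set Implicit Arguments.
Unset Strict Implicit.
Unset Printing Implicit Defensive.

Local Open Scope classical_set_scope.
Local Open Scope ring_scope.

(* A family {f_n : n = 1, 2, ...} of bijections is encoded by
   F : nat -> {splitbij [set: X] >-> [set: X]} with F i standing for f_(i+1).
   An element of {splitbij [set: X] >-> [set: X]} is a map X -> X bundled with
   its (unique) two-sided inverse, written (F i)^-1. *)

Definition homeomorphism (X : topologicalType)
    (f : {splitbij [set: X] >-> [set: X]}) : Prop :=
  continuous f /\ continuous (f^-1)%FUN.

Definition commutative_family (X : Type)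
    (F : nat -> {splitbij [set: X] >-> [set: X]}) : Prop :=
  forall n m : nat, F n \o F m = F m \o F n :> (X -> X).

(* omega F k is f_k o ... o f_1 for k > 0, and with n := |k| it is
   f_n^-1 o ... o f_1^-1 for k < 0, hence not the inverse of omega F n
   in general. *)
Section NonAutonomous.
Variables (X : Type) (F : nat -> {splitbij [set: X] >-> [set: X]}).

Fixpoint omega_fwd (n : nat) (x : X) : X :=
  if n is m.+1 then F m (omega_fwd m x) else x.

(* omega_bwd n is the time -n state *)
Fixpoint omega_bwd (n : nat) (x : X) : X :=
  if n is m.+1 then ((F m)^-1)%FUN (omega_bwd m x) else x.

(* Negz n is the integer - (n + 1) *)
Definition omega (k : int) : X -> X :=
  match k with
  | Posz n => omega_fwd n
  | Negz n => omega_bwd n.+1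
  end.

Definition system_orbit (x : X) : set X := [set omega k x | k in [set: int]].

Definition invariant_set (Y : set X) : Prop :=
  forall k : int, omega k @` Y `<=` Y.

End NonAutonomous.

Definition topologically_transitive (X : topologicalType)
    (F : nat -> {splitbij [set: X] >-> [set: X]}) : Prop :=
  forall U V : set X, open U -> U !=set0 -> open V -> V !=set0 ->
    exists k : int, (omega F k @` U) `&` V !=set0.

Definition minimal_system (X : topologicalType)
    (F : nat -> {splitbij [set: X] >-> [set: X]}) : Prop :=
  [set: X] !=set0 /\
  ~ exists Y : set X,
      [/\ Y !=set0, Y `<` [set: X], closed Y & invariant_set F Y].

(* Uniform in the base point, unlike the library's pointwise [equicontinuous] *)
Definition equicontinuous_system (R : realType) (X : metricType R)
    (F : nat -> {splitbij [set: X] >-> [set: X]}) : Prop :=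
  forall e : R, 0 < e -> exists d : R, 0 < d /\
    forall x y : X, mdist x y < d ->
      forall k : int, mdist (omega F k x) (omega F k y) < e.

(* Main.v *)
Require Import Defs.
From mathcomp Require Import all_boot all_order all_algebra.
From mathcomp Require Import all_classical all_reals all_analysis.

Local Open Scope classical_set_scope.
Local Open Scope ring_scope.

Import Order.TTheory GRing.Theory Num.Theory.

(** If every orbit is dense, the orbit of any point of [U] meets [V], which is transitivity;
    minimality follows because a closed invariant set contains the closure of the orbit of each of
    its points. Conversely, transitivity only yields some [z] near [x] that visits a given open set,
    and equicontinuity, uniform over all integer times, transfers this visit to [x] itself
    ([equicontinuous_transitive_dense_orbits]). *)

Lemma dense_orbits_transitive (X : topologicalType)
    (F : nat -> {splitbij [set: X] >-> [set: X]}) :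
  (forall x : X, dense (system_orbit F x)) -> topologically_transitive F.
Proof.
move=> orbit_dense U V _ [x Ux] openV V0.
have [_ [/[swap] -[k _ <-] Vy]] := orbit_dense x V V0 openV.
by exists k, (omega F k x); split => //; exists x.
Qed.

Lemma dense_orbits_minimal (X : topologicalType)
    (F : nat -> {splitbij [set: X] >-> [set: X]}) :
  [set: X] !=set0 -> (forall x : X, dense (system_orbit F x)) ->
  minimal_system F.
Proof.
move=> X0 orbit_dense; split=> // -[Y [[y Yy] [_ YNT] closedY Yinv]].
apply: YNT => z _; apply: contrapT => NYz.
(* By density the orbit of [y] enters the open complement of [Y], which contains [z]; by invariance
   it never leaves [Y]. *)
have [_ [/[swap] -[k _ <-]]] :=
  orbit_dense y (~` Y) (ex_intro _ z NYz) (closed_openC closedY).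
by apply; apply: (Yinv k); exists y.
Qed.

(* Transitivity moves some z near x close to y, and by equicontinuity the
   orbit of x stays close to that of z at all times. *)
Lemma equicontinuous_transitive_dense_orbits (R : realType) (X : metricType R)
    (F : nat -> {splitbij [set: X] >-> [set: X]}) :
  equicontinuous_system F -> topologically_transitive F ->
  forall x : X, dense (system_orbit F x).
Proof.
move=> F_equi F_trans x O [y Oy] openO.
have /nbhs_ballP[e /= e0 yeO] : nbhs y O by exact: open_nbhs_nbhs.
(* One half of [e] bounds the distance from [y] to [omega F k z], the other that from [omega F k z]
   to [omega F k x]. *)
have e20 : 0 < e / 2 by rewrite divr_gt0.
have [d [d0 xd]] := F_equi _ e20.
(* Interiors of the balls serve as the open sets that transitivity asks for; each contains its
   centre. *)
have [k [_ [[z xz <-] yz]]] : exists k : int,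
    (omega F k @` (ball x d)^°) `&` (ball y (e / 2))^° !=set0.
  apply: F_trans; [exact: open_interior| |exact: open_interior|].
    by exists x; exact: nbhsx_ballx.
  by exists y; exact: nbhsx_ballx.
exists (omega F k x); split; last by exists k.
apply: yeO; rewrite [e]splitr.
apply: (ball_triangle (interior_subset yz)).
apply: ball_sym; rewrite ballEmdist /=.
by apply: xd; move/interior_subset: xz; rewrite ballEmdist.
Qed.

Theorem proposition10 (R : realType) (X : metricType R)
    (F : nat -> {splitbij [set: X] >-> [set: X]})
    (X_nonempty : [set: X] !=set0)
    (X_compact : compact [set: X])
    (F_homeo : forall n : nat, homeomorphism (F n))
    (F_comm : commutative_family F)
    (F_equi : equicontinuous_system F) :
  (topologically_transitive F <-> forall x : X, dense (system_orbit F x)) /\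
  (topologically_transitive F -> minimal_system F).
Proof.
have dense_of_trans := equicontinuous_transitive_dense_orbits _ _ _ F_equi.
split; first by split; [exact: dense_of_trans|exact: dense_orbits_transitive].
by move=> /dense_of_trans; exact: dense_orbits_minimal.
Qed.
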